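(* Let $T$ be a triangularizable polynomially Riesz operator on a complex Banach space $X$. Then for every triangularizing chain $\mathcal C$ of the operator $T$ we have $$\sigma(T)=\sigma_e(T)\cup\{\lambda_{\mathcal M}:\ \mathcal M\in\mathcal C,\ \mathcal M\neq\mathcal M_-\}.$$
   Context: $\mathcal B(X)$ is the Banach algebra of bounded linear operators on $X$, $\mathcal K(X)$ its closed ideal of compact operators, and $\pi\colon\mathcal B(X)\to\mathcal B(X)/\mathcal K(X)$ the canonical projection onto the Calkin algebra. $\sigma(T)$ is the spectrum of $T$ in $\mathcal B(X)$, and $\sigma_e(T):=\sigma(\pi(T))$ is the spectrum of $\pi(T)$ in the Calkin algebra. $T$ is a Riesz operator if $\pi(T)$ is quasinilpotent, i.e. $\lim_n\|\pi(T)^n\|^{1/n}=0$; $T$ is polynomially Riesz if $p(T)$ is a Riesz operator for some non-zero complex polynomial $p$. $T$ is triangularizable if there is a maximal chain $\mathcal C$ of closed subspaces of $X$ (maximal among all chains of closed subspaces, ordered by inclusion) each member of which is invariant under $T$; such a $\mathcal C$ is called a triangularizing chain of $T$. For $\mathcal M\in\mathcal C$, the predecessor $\mathcal M_-$ is the closed linear span of all proper subspaces of $\mathcal M$ belonging to $\mathcal C$; by maximality, $\mathcal M_-\in\mathcal C$ and $\dim(\mathcal M/\mathcal M_-)\le 1$. If $\mathcal M\ne\mathcal M_-$, then $T$ induces on the one-dimensional space $\mathcal M/\mathcal M_-$ multiplication by a uniquely determined number $\lambda_{\mathcal M}$, called the diagonal coefficient of $T$ with respect to $\mathcal M$. *)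

(* Defs.v *)
From HB Require Import structures.
From mathcomp Require Import all_boot all_order all_algebra ring_quotient.
From mathcomp Require Import generic_quotient complex.
From mathcomp Require Import all_classical all_reals all_analysis.

Set Implicit Arguments.
Unset Strict Implicit.
Unset Printing Implicit Defensive.

Import Order.TTheory GRing.Theory Num.Theory.
Import numFieldNormedType.Exports.

Local Open Scope classical_set_scope.
Local Open Scope ring_scope.
Local Open Scope complex_scope.
Local Open Scope quotient_scope.

(* algType excludes the zero algebra, but B(X) is zero when X = 0 and the
   Calkin algebra is zero when X is finite-dimensional.  The spectrum is hence
   defined over a pzRingType A given with the embedding l |-> l 1 of the
   scalars; it is empty when A is zero. *)
Definition invertible (A : pzRingType) (a : A) :=
  exists b : A, a * b = 1 /\ b * a = 1.

Definition spectrum_in (K : Type) (A : pzRingType) (scal : K -> A) (a : A) :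
  set K := [set l | ~ invertible (a - scal l)].

Section BoundedOperators.
Context {R : realType} {X : completeNormedModType R[i]}.
Implicit Types f g : X -> X.

Definition bounded_linear : {pred (X -> X)} := fun f =>
  `[< linear f /\ exists M : R[i], forall x, `|f x| <= M * `|x| >].

Lemma bounded_linear_submod : GRing.submod_closed bounded_linear.
Proof.
split=> [|a f g]; rewrite !unfold_in; first (apply/asboolP; split).
- by move=> a x y; rewrite [RHS](_ : _ = a *: 0 + 0)// scaler0 addr0.
- by exists 0 => x; rewrite mul0r normr0.
move=> /asboolP[lf [M fM]] /asboolP[lg [N gN]]; apply/asboolP; split.
  move=> b x y; rewrite !fctE lf lg !scalerDr !scalerA mulrC.
  by rewrite -!addrA; congr (_ + _); rewrite addrCA.
exists (`|a| * M + N) => x; rewrite !fctE (le_trans (ler_normD _ _))//.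
by rewrite mulrDl lerD// normrZ -mulrA ler_wpM2l.
Qed.

HB.instance Definition _ :=
  GRing.isSubmodClosed.Build R[i] (X -> X) bounded_linear bounded_linear_submod.

End BoundedOperators.

Record bop (R : realType) (X : completeNormedModType R[i]) := Bop {
  bop_fun :> X -> X;
  bop_boundedP : bop_fun \in bounded_linear
}.

Section BopLmodule.
Context {R : realType} {X : completeNormedModType R[i]}.

HB.instance Definition _ := [isSub for @bop_fun R X].
HB.instance Definition _ := [Choice of bop X by <:].
HB.instance Definition _ := [SubChoice_isSubLmodule of bop X by <:].

Lemma bopP (T : bop X) :
  linear T /\ exists M : R[i], forall x, `|T x| <= M * `|x|.
Proof. by have := valP T; rewrite unfold_in => /asboolP. Qed.

HB.instance Definition _ (T : bop X) :=
  GRing.isLinear.Build R[i] X X *:%R T (bopP T).1.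

Lemma bop_ext (S T : bop X) : S =1 T -> S = T.
Proof. by move=> ST; apply/val_inj/funext. Qed.

Lemma bopDE (S T : bop X) x : (S + T) x = S x + T x. Proof. by []. Qed.
Lemma bopNE (T : bop X) x : (- T) x = - T x. Proof. by []. Qed.
Lemma bopZE (a : R[i]) (T : bop X) x : (a *: T) x = a *: T x. Proof. by []. Qed.
End BopLmodule.

Section BopRing.
Context {R : realType} {X : completeNormedModType R[i]}.
Implicit Types S T U : bop X.

Lemma id_bounded_linear : (@id X) \in bounded_linear.
Proof.
by rewrite unfold_in; apply/asboolP; split=> //; exists 1 => x; rewrite mul1r.
Qed.

Lemma bop_bound T : exists2 M : R[i], 0 < M & forall x, `|T x| <= M * `|x|.
Proof.
have [_ [M TM]] := bopP T; exists (`|M| + 1); first by rewrite ltr_wpDl.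
move=> x; rewrite (le_trans (TM x))// mulrDl mul1r.
have M0 : 0 <= M * `|x| by rewrite (le_trans _ (TM x)).
by rewrite -(ger0_norm M0) normrM normr_id lerDl.
Qed.

Lemma comp_bounded_linear S T : (S \o T) \in bounded_linear.
Proof.
rewrite unfold_in; apply/asboolP; split=> [a x y|]; first by rewrite /= !linearP.
have [M M0 SM] := bop_bound S; have [N N0 TN] := bop_bound T.
exists (M * N) => x; rewrite (le_trans (SM _))// -mulrA.
by rewrite ler_wpM2l// ltW.
Qed.

Definition bop_one : bop X := Bop id_bounded_linear.
Definition bop_mul S T : bop X := Bop (comp_bounded_linear S T).

Lemma bop_mulA : associative bop_mul.
Proof. by move=> S T U; apply: bop_ext. Qed.
Lemma bop_mul1 : left_id bop_one bop_mul.
Proof. by move=> T; apply: bop_ext. Qed.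
Lemma bop_mulr1 : right_id bop_one bop_mul.
Proof. by move=> T; apply: bop_ext. Qed.
Lemma bop_mulDl : left_distributive bop_mul +%R.
Proof. by move=> S T U; apply: bop_ext. Qed.
Lemma bop_mulDr : right_distributive bop_mul +%R.
Proof. by move=> S T U; apply: bop_ext => x; rewrite /= linearD. Qed.

HB.instance Definition _ := GRing.Zmodule_isPzRing.Build (bop X)
  bop_mulA bop_mul1 bop_mulr1 bop_mulDl bop_mulDr.

Lemma bopME S T x : (S * T) x = S (T x). Proof. by []. Qed.
Lemma bop1E x : (1 : bop X) x = x. Proof. by []. Qed.

Lemma bop_continuous T : continuous T.
Proof.
have [M M0 TM] := bop_bound T.
apply: bounded_linear_continuous; apply/linear_boundedP.
exists M; split=> [|r /ltW Mr x]; first exact: gtr0_real.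
by rewrite (le_trans (TM x))// ler_wpM2r.
Qed.
End BopRing.

Section CompactOperators.
Context {R : realType} {X : completeNormedModType R[i]}.
Implicit Types S T : bop X.

Definition compact_op : {pred bop X} := fun T =>
  `[< precompact (T @` [set x | `|x| <= 1]) >].

Lemma precompact_sub_compact (A K : set X) :
  compact K -> A `<=` K -> precompact A.
Proof.
move=> cK AK; apply: (precompact_subset AK).
by apply: compact_precompact => //; exact: norm_hausdorff.
Qed.

Lemma compact_opP T : reflect
  (exists2 K, compact K & forall x, `|x| <= 1 -> K (T x)) (T \in compact_op).
Proof.
rewrite unfold_in; apply: (iffP (asboolP _)) => [[K TK [cK _]]|[K cK TK]].
  by exists K => // x x1; apply: TK; exists x.
by apply: (precompact_sub_compact cK) => _ [x /= x1 <-]; exact: TK.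
Qed.

Lemma compact_op_zmod : zmod_closed compact_op.
Proof.
split=> [|S T /compact_opP[K cK SK] /compact_opP[L cL TL]].
  by apply/compact_opP; exists [set 0] => //; exact: compact_set1.
apply/compact_opP; exists ((fun z : X * X => z.1 - z.2) @` (K `*` L)).
  apply: continuous_compact (compact_setX cK cL).
  apply: continuous_subspaceT => -[x y].
  apply: (@cvgB _ _ _ (nbhs (x, y))); [exact: cvg_fst|exact: cvg_snd].
by move=> x x1; exists (S x, T x) => //; split; [exact: SK|exact: TL].
Qed.

HB.instance Definition _ :=
  GRing.isZmodClosed.Build (bop X) compact_op compact_op_zmod.

Lemma compact_opMl S T : T \in compact_op -> S * T \in compact_op.
Proof.
move=> /compact_opP[K cK TK]; apply/compact_opP; exists (S @` K).
  apply: continuous_compact cK; apply: continuous_subspaceT.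
  exact: bop_continuous.
by move=> x x1; exists (T x) => //; exact: TK.
Qed.

Lemma compact_opMr S T : S \in compact_op -> S * T \in compact_op.
Proof.
move=> /compact_opP[K cK SK]; apply/compact_opP.
have [M M0 TM] := bop_bound T; exists (( *:%R M) @` K).
  apply: continuous_compact cK; apply: continuous_subspaceT => x.
  exact: scaler_continuous.
move=> x x1; exists (S (M^-1 *: T x)).
  apply: SK; rewrite normrZ normfV gtr0_norm// ler_pdivrMl// mulr1.
  by rewrite (le_trans (TM x))// ler_piMr// ltW.
by rewrite linearZ scalerA divff ?scale1r// gt_eqF.
Qed.

End CompactOperators.

(* ring_quotient only equips quotients of commutative rings with a product. *)
Definition calkin (R : realType) (X : completeNormedModType R[i]) : Type :=
  Quotient.quot (@compact_op R X).

Section Calkin.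
Context {R : realType} {X : completeNormedModType R[i]}.

HB.instance Definition _ := GRing.Zmodule.on (calkin X).

Definition calkin_pi (T : bop X) : calkin X := \pi_(Quotient.quot compact_op) T.

Definition calkin_repr (a : calkin X) : bop X :=
  repr (a : Quotient.quot compact_op).

Lemma calkin_reprK : cancel calkin_repr calkin_pi.
Proof. exact: reprK. Qed.

Lemma calkin_piE (S T : bop X) :
  calkin_pi S = calkin_pi T <-> S - T \in compact_op.
Proof.
rewrite /calkin_pi; split=> [ST|]; first by rewrite Quotient.idealrBE; apply/eqP.
by rewrite Quotient.idealrBE => /eqP.
Qed.

Lemma calkin_repr_pi (T : bop X) : calkin_repr (calkin_pi T) - T \in compact_op.
Proof. by apply/calkin_piE; rewrite calkin_reprK. Qed.

Lemma calkin_piD (S T : bop X) :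
  calkin_pi (S + T) = calkin_pi S + calkin_pi T.
Proof. exact: (@pi_addr _ _ _ _ _ (Quotient.quot compact_op)). Qed.

Definition calkin_one : calkin X := calkin_pi 1.
Definition calkin_mul (a b : calkin X) : calkin X :=
  calkin_pi (calkin_repr a * calkin_repr b).

Lemma calkin_mul_pi (S T : bop X) :
  calkin_mul (calkin_pi S) (calkin_pi T) = calkin_pi (S * T).
Proof.
apply/calkin_piE; set S' := calkin_repr _; set T' := calkin_repr _.
have -> : S' * T' - S * T = S' * (T' - T) + (S' - S) * T.
  by rewrite mulrBr mulrBl addrA subrK.
by apply: rpredD; [apply: compact_opMl|apply: compact_opMr];
  exact: calkin_repr_pi.
Qed.

Lemma calkin_mulA : associative calkin_mul.
Proof.
move=> a b c; rewrite -[a]calkin_reprK -[b]calkin_reprK -[c]calkin_reprK.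
by rewrite !calkin_mul_pi mulrA.
Qed.
Lemma calkin_mul1 : left_id calkin_one calkin_mul.
Proof. by move=> a; rewrite -[a]calkin_reprK calkin_mul_pi mul1r. Qed.
Lemma calkin_mulr1 : right_id calkin_one calkin_mul.
Proof. by move=> a; rewrite -[a]calkin_reprK calkin_mul_pi mulr1. Qed.
Lemma calkin_mulDl : left_distributive calkin_mul +%R.
Proof.
move=> a b c; rewrite -[a]calkin_reprK -[b]calkin_reprK -[c]calkin_reprK.
by rewrite -calkin_piD !calkin_mul_pi -calkin_piD mulrDl.
Qed.
Lemma calkin_mulDr : right_distributive calkin_mul +%R.
Proof.
move=> a b c; rewrite -[a]calkin_reprK -[b]calkin_reprK -[c]calkin_reprK.
by rewrite -calkin_piD !calkin_mul_pi -calkin_piD mulrDr.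
Qed.

HB.instance Definition _ := GRing.Zmodule_isPzRing.Build (calkin X)
  calkin_mulA calkin_mul1 calkin_mulr1 calkin_mulDl calkin_mulDr.

Lemma calkin_pi_zmod_morphism : zmod_morphism calkin_pi.
Proof. exact: (pi_is_zmod_morphism (Quotient.quot compact_op)). Qed.

Lemma calkin_pi_monoid_morphism : monoid_morphism calkin_pi.
Proof. by split=> // S T; rewrite -calkin_mul_pi. Qed.

HB.instance Definition _ :=
  GRing.isZmodMorphism.Build (bop X) (calkin X) calkin_pi
    calkin_pi_zmod_morphism.
HB.instance Definition _ :=
  GRing.isMonoidMorphism.Build (bop X) (calkin X) calkin_pi
    calkin_pi_monoid_morphism.

End Calkin.

Section Spectra.
Context {R : realType} {X : completeNormedModType R[i]}.
Implicit Types T : bop X.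

Definition spectrum T : set R[i] := spectrum_in (fun l : R[i] => l *: (1 : bop X)) T.

(* calkin_pi (l *: 1) is l times the unit of the quotient algebra. *)
Definition essential_spectrum T : set R[i] :=
  spectrum_in (fun l : R[i] => calkin_pi (l *: (1 : bop X))) (calkin_pi T).

(* The norm of X takes its values in R[i]; they are real. *)
Definition op_norm T : R :=
  sup [set complex.Re `|T x| | x in [set x | `|x| <= 1]].

Definition calkin_norm (a : calkin X) : R :=
  inf [set op_norm T | T in [set T | calkin_pi T = a]].

Definition riesz T :=
  (fun n => calkin_norm (calkin_pi T ^+ n) `^ n%:R^-1) @ \oo --> (0 : R).

(* horner_alg is only available for nonzero algebras. *)
Definition poly_bop (p : {poly R[i]}) T : bop X :=
  \sum_(i < size p) p`_i *: T ^+ i.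

Definition polynomially_riesz T :=
  exists p : {poly R[i]}, p != 0 /\ riesz (poly_bop p T).

End Spectra.

Section Triangularization.
Context {R : realType} {X : completeNormedModType R[i]}.
Implicit Types (T : bop X) (M N : set X) (C D : set (set X)).

Definition closed_subspace M :=
  [/\ closed M, M 0 & forall (a : R[i]) x y, M x -> M y -> M (a *: x + y)].

Definition subspace_chain C :=
  C `<=` closed_subspace /\ total_on C (fun M N => M `<=` N).

Definition maximal_subspace_chain C :=
  subspace_chain C /\ forall D, subspace_chain D -> C `<=` D -> D = C.

Definition invariant T M := T @` M `<=` M.

Definition triangularizing_chain T C :=
  maximal_subspace_chain C /\ forall M, C M -> invariant T M.

Definition triangularizable T := exists C, triangularizing_chain T C.

Definition closed_span (A : set X) : set X := smallest closed_subspace A.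

Definition predecessor C M : set X :=
  closed_span (\bigcup_(N in [set N | C N /\ N `<` M]) N).

Lemma closed_span_subspace (A : set X) : closed_subspace (closed_span A).
Proof.
split.
- by apply: closed_bigI => M /= [[]].
- by move=> M [[]].
- move=> a x y Ax Ay M MA; have [[_ _ Mlin] _] := MA.
  by apply: Mlin; [exact: Ax|exact: Ay].
Qed.

Lemma predecessor_sub C M : closed_subspace M -> predecessor C M `<=` M.
Proof.
move=> sM; apply: smallest_sub => //.
by apply: bigcup_sub => N /= [_ /properW].
Qed.

(* The operator induced by T on M / M_- is multiplication by l. *)
Definition diagonal_coefficient T C M (l : R[i]) :=
  forall x, M x -> predecessor C M (T x - l *: x).

Lemma diagonal_coefficient_unique T C M (l l' : R[i]) :
  closed_subspace M -> M <> predecessor C M ->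
  diagonal_coefficient T C M l -> diagonal_coefficient T C M l' -> l = l'.
Proof.
move=> sM nMP Tl Tl'; apply/eqP; apply: contra_notT nMP => ll'.
apply/seteqP; split; last exact: predecessor_sub.
move=> x Mx; have [_ P0 Plin] := closed_span_subspace
  (\bigcup_(N in [set N | C N /\ N `<` M]) N).
have /(Plin (l' - l)^-1 _ 0)/(_ P0) := Plin (-1) _ _ (Tl' x Mx) (Tl x Mx).
rewrite scaleN1r addr0 opprB addrA subrK -scalerBl scalerA mulVf ?scale1r//.
by rewrite subr_eq0 eq_sym.
Qed.

Definition diagonal_coefficients T C : set R[i] :=
  [set l | exists M,
    [/\ C M, M <> predecessor C M & diagonal_coefficient T C M l]].

End Triangularization.

(* Main.v *)
Require Import Defs.
From mathcomp Require Import all_boot all_order all_algebra complex.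
From mathcomp Require Import all_classical all_reals all_analysis.
From mathcomp Require Import lra.
Import Order.TTheory GRing.Theory Num.Theory.
Import numFieldNormedType.Exports.
Local Open Scope classical_set_scope.
Local Open Scope ring_scope.
Local Open Scope complex_scope.

Set Implicit Arguments.
Unset Strict Implicit.
Unset Printing Implicit Defensive.

(** The inclusion of the essential spectrum in the spectrum holds because the
Calkin projection preserves inverses.  So fix l outside the essential spectrum,
and put B = T - l.  What has to be shown is that B is not invertible if and
only if l is a diagonal coefficient.

Let p(T) be a Riesz operator, with p <> 0.  As B is invertible modulo the
compact operators, the factors X - l of p can be divided out, and p(l) = 1 may
be assumed.  By quasinilpotence in the Calkin algebra, a power Q of p(T) is the
sum of a compact operator and of an operator of norm at most 1/8; as 1 - p^n
vanishes at l, 1 - Q = B G where G is a polynomial in T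
([polynomially_riesz_compact_plus_small]).  Only a bounded amount of
compactness survives in Q, but it is enough for the classical argument of
F. Riesz on ascent and descent: Q cannot map a sequence of unit vectors to a
sequence whose terms are at distance at least 1/2 from each other.  This
property, unlike compactness of the summand, passes to every closed subspace N
invariant under T, since G and Q leave N invariant as well; and B^n N is closed,
since B has a left inverse modulo the compact operators
([closed_subspace_image]).  Hence, on each such N, B is injective if and only if
it maps N onto N ([injective_surjective] and [surjective_injective]).  Neither Riesz projections
nor the index enter.

If l is the diagonal coefficient at M, then B maps M into its predecessor, a
proper subspace, hence B is not onto M, hence not injective.

Conversely, if B is not invertible, it has a nonzero kernel.  The unit sphere
of the kernel is compact, so that the members of the chain that meet it have an
intersection M that also meets it, say at x; by maximality M is in the chain,
and it is the smallest member on which B is not injective.  Hence B maps every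
member N strictly below M onto N.  If x were in the predecessor of M, the
predecessor would be M itself by minimality; the closed subspace B M contains
all those N, so it would be M, and B would be injective on M, contrary to
B x = 0.  So x is outside the predecessor, which together with x spans M by
maximality of the chain, and T x = l x makes l the diagonal coefficient
at M. *)

(** * The real-valued norm *)

Section RealNorm.
Context {R : realType} {X : completeNormedModType R[i]}.
Implicit Types (x y z : X) (S T : bop X) (N : set X).

(** The norm takes its values in R[i], whose order is partial; its real part
determines it, and can be compared with arbitrary elements of R. *)
Definition rnorm x : R := complex.Re `|x|.

Lemma rnormE x : `|x| = (rnorm x)%:C.
Proof.
rewrite /rnorm; have := normr_ge0 x.
by case: `|x| => a b; rewrite lecE /= => /andP[/eqP-> _].
Qed.

Lemma rnorm_ge0 x : 0 <= rnorm x.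
Proof. by rewrite -ler0c -rnormE. Qed.

Lemma rnorm_eq0 x : (rnorm x == 0) = (x == 0).
Proof. by rewrite -[RHS]normr_eq0 rnormE eq_complex /= eqxx andbT. Qed.

Lemma rnorm0 : rnorm 0 = 0.
Proof. by apply/eqP; rewrite rnorm_eq0. Qed.

Lemma rnorm_gt0 x : x != 0 -> 0 < rnorm x.
Proof. by move=> x0; rewrite lt_neqAle eq_sym rnorm_eq0 x0 rnorm_ge0. Qed.

Lemma rnormN x : rnorm (- x) = rnorm x.
Proof. by rewrite /rnorm normrN. Qed.

Lemma rnormB x y : rnorm (x - y) = rnorm (y - x).
Proof. by rewrite -rnormN opprB. Qed.

Lemma rnormD x y : rnorm (x + y) <= rnorm x + rnorm y.
Proof. by rewrite -lecR rmorphD /= -!rnormE ler_normD. Qed.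

Lemma rnorm_dist x y z : rnorm (x - z) <= rnorm (x - y) + rnorm (y - z).
Proof. by rewrite (le_trans _ (rnormD _ _))// addrA subrK. Qed.

Lemma rnormZ (a : R[i]) x : rnorm (a *: x) = complex.Re `|a| * rnorm x.
Proof.
rewrite /rnorm normrZ (rnormE x) -[`|a|](RRe_real (normr_real a)).
by rewrite -rmorphM /=.
Qed.

Lemma rnormZr (a : R) x : 0 <= a -> rnorm (a%:C *: x) = a * rnorm x.
Proof. by move=> a0; rewrite rnormZ ger0_norm ?ler0c. Qed.

Lemma le_rnorm x (e : R) : (`|x| <= e%:C) = (rnorm x <= e).
Proof. by rewrite rnormE lecR. Qed.

Lemma rnorm_small0 x : (forall e : R, 0 < e -> rnorm x < e) -> x = 0.
Proof.
move=> xe; apply/eqP; apply: contraT => /rnorm_gt0 /[dup] /xe.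
by rewrite ltxx.
Qed.

Lemma bop_rbound T :
  exists2 M : R, 0 < M & forall x, rnorm (T x) <= M * rnorm x.
Proof.
have [M M0 TM] := bop_bound T.
have ME : M = (complex.Re M)%:C by rewrite RRe_real// gtr0_real.
exists (complex.Re M); first by rewrite -ltcR -ME.
by move=> x; rewrite -lecR rmorphM /= -ME -!rnormE.
Qed.

Lemma bop_linearZ T (a : R[i]) x : T (a *: x) = a *: T x.
Proof. exact: linearZ. Qed.

Lemma nbhs_rnorm x (A : set X) :
  nbhs x A <-> exists2 e : R, 0 < e & forall y, rnorm (x - y) < e -> A y.
Proof.
split=> [/nbhs_ballP[e /= e0 xA]|[e e0 xA]].
  have eE : e = (complex.Re e)%:C by rewrite RRe_real// gtr0_real.
  exists (complex.Re e) => [|y xy]; first by rewrite -ltcR -eE.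
  by apply: xA; rewrite -ball_normE /= eE rnormE ltcR.
apply/nbhs_ballP; exists e%:C => /=; first by rewrite ltcR.
by move=> y; rewrite -ball_normE /= rnormE ltcR; exact: xA.
Qed.

Lemma closed_rnormP N :
  closed N <->
  forall x, (forall e : R, 0 < e -> exists2 y, N y & rnorm (x - y) < e) -> N x.
Proof.
split=> [cN x xN|cN x xN].
  apply: cN => A /nbhs_rnorm[e e0 xA].
  by have [y Ny xy] := xN e e0; exists y; split=> //; exact: xA.
apply: cN => e e0; have [|y [Ny xy]] := xN [set y | rnorm (x - y) < e].
  by apply/nbhs_rnorm; exists e.
by exists y.
Qed.

(** Continuity in the form in which it applies to cluster points: the point z may
depend on e, and no sequence converging to x has to be extracted. *)
Lemma bop_lim T x y :
  (forall e : R, 0 < e -> exists2 z, rnorm (x - z) < e & rnorm (y - T z) < e) ->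
  T x = y.
Proof.
move=> xy; have [M M0 TM] := bop_rbound T; apply/subr0_eq/rnorm_small0 => e e0.
have [|z xz yz] := xy (e / (M + 1)); first by rewrite divr_gt0// addr_gt0.
rewrite (le_lt_trans (rnorm_dist _ (T z) _))// -linearB (rnormB (T z)).
have eE : e = M * (e / (M + 1)) + e / (M + 1).
  by rewrite -{2}[e / _]mul1r -mulrDl mulrCA divff ?mulr1// gt_eqF// addr_gt0.
rewrite [ltRHS]eE ler_ltD// (le_trans (TM _))// ler_wpM2l//; exact: ltW.
Qed.

Lemma closed_preimage T N : closed N -> closed (T @^-1` N).
Proof.
by move=> cN; apply: preimage_closed => // x _; exact: bop_continuous.
Qed.

Lemma closed_subspace_preimage T N :
  closed_subspace N -> closed_subspace (T @^-1` N).
Proof.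
move=> [cN N0 Nlin]; split; first exact: closed_preimage.
  by rewrite /= linear0.
by move=> a x y Nx Ny /=; rewrite linearP; exact: Nlin.
Qed.

(** Cluster points serve in place of limits of subsequences. *)
Lemma compact_seq_cluster (L : set X) (u : nat -> X) :
  compact L -> (forall n, L (u n)) ->
  exists w, forall (e : R) m, 0 < e ->
    exists2 n, (m <= n)%N & rnorm (w - u n) < e.
Proof.
move=> cL Lu; have [|w [_ uw]] := cL (u @ \oo) _.
  by exists 0%N => // n _; exact: Lu.
exists w => e m e0.
have [||_ [[n /= mn <-] wn]] := uw (u @` [set n | (m <= n)%N])
  [set y | rnorm (w - y) < e].
- by exists m => // n mn; exists n.
- by apply/nbhs_rnorm; exists e.
- by exists n.
Qed.

Lemma compact_op_seq_cluster T (r : R) (u : nat -> X) : T \in compact_op ->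
  (forall n, rnorm (u n) <= r) ->
  exists w, forall (e : R) m, 0 < e ->
    exists2 n, (m <= n)%N & rnorm (w - T (u n)) < e.
Proof.
move=> /compact_opP[L cL TL] ur.
pose s : R := `|r| + 1; have s0 : 0 < s by rewrite ltr_wpDl.
have sC0 : s%:C != 0 :> R[i] by rewrite gt_eqF// ltcR.
have [|n|w wu] := @compact_seq_cluster (( *:%R s%:C) @` L) (T \o u).
- apply: continuous_compact cL; apply: continuous_subspaceT => x.
  exact: scaler_continuous.
- exists (T (s%:C^-1 *: u n)); last by rewrite linearZ scalerA divff ?scale1r.
  apply: TL; rewrite -fmorphV -[1]/(1%:C) le_rnorm.
  rewrite rnormZr ?invr_ge0 ?(ltW s0)//.
  rewrite ler_pdivrMl// mulr1 (le_trans (ur n))// (le_trans (ler_norm r))//.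
  by rewrite lerDl.
- by exists w.
Qed.

End RealNorm.

(** * Closed subspaces and closed images *)

Section Subspaces.
Context {R : realType} {X : completeNormedModType R[i]}.
Implicit Types (x y z : X) (B C : bop X) (M N Z : set X).

Lemma closed_subspaceD N x y : closed_subspace N -> N x -> N y -> N (x + y).
Proof. by move=> [_ _ Nlin] Nx Ny; rewrite -[x]scale1r; exact: Nlin. Qed.

Lemma closed_subspaceZ N (a : R[i]) x : closed_subspace N -> N x -> N (a *: x).
Proof. by move=> [_ N0 Nlin] Nx; rewrite -[_ *: _]addr0; exact: Nlin. Qed.

Lemma closed_subspaceN N x : closed_subspace N -> N x -> N (- x).
Proof. by move=> sN Nx; rewrite -scaleN1r; exact: closed_subspaceZ. Qed.

Lemma closed_subspaceB N x y : closed_subspace N -> N x -> N y -> N (x - y).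
Proof.
by move=> sN Nx Ny; apply: closed_subspaceD => //; exact: closed_subspaceN.
Qed.

Lemma closed_subspaceT : closed_subspace (@setT X).
Proof. by split=> //; exact: closedT. Qed.

Lemma closed_subspace_set0 : closed_subspace [set (0 : X)].
Proof.
split=> //; last by move=> a x y -> ->; rewrite scaler0 addr0.
apply/closed_rnormP => x x0; apply: rnorm_small0 => e /x0[y ->].
by rewrite subr0.
Qed.

Lemma closed_subspace_bigI (F : set (set X)) :
  F `<=` closed_subspace -> closed_subspace (\bigcap_(N in F) N).
Proof.
move=> sF; split.
- by apply: closed_bigI => N /sF[].
- by move=> N /sF[].
- move=> a x y Fx Fy N FN; have [_ _ Nlin] := sF N FN.
  by apply: Nlin; [exact: Fx|exact: Fy].
Qed.

Lemma closed_subspaceI M N :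
  closed_subspace M -> closed_subspace N -> closed_subspace (M `&` N).
Proof.
move=> [cM M0 Mlin] [cN N0 Nlin]; split; first exact: closedI.
  by [].
by move=> a x y [? ?] [? ?]; split; [exact: Mlin|exact: Nlin].
Qed.

(** In an infinite-dimensional space the distance to Z need not be attained; a
factor 2 of slack makes up for it. *)
Lemma almost_nearest Z x : closed_subspace Z ->
  exists2 z, Z z & forall z', Z z' -> rnorm (x - z) <= 2 * rnorm (x - z').
Proof.
move=> [cZ Z0 _]; have [Zx|nZx] := pselect (Z x).
  by exists x => // z' _; rewrite subrr rnorm0 mulr_ge0// rnorm_ge0.
pose D := [set rnorm (x - z) | z in Z].
have D_lb : has_inf D.
  split; first by exists (rnorm (x - 0)), 0.
  by exists 0 => _ [z _ <-]; exact: rnorm_ge0.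
have [e e0 De] : exists2 e : R, 0 < e & forall z, Z z -> e <= rnorm (x - z).
  apply: contra_notP nZx => ne; apply: (closed_rnormP Z).1 => // e e0.
  apply: contra_notP ne => nz; exists e => // z Zz; rewrite leNgt.
  by apply/negP => xz; apply: nz; exists z.
have D0 : 0 < inf D.
  apply: (lt_le_trans e0); apply: lb_le_inf; first by exists (rnorm (x - 0)), 0.
  by move=> _ [z Zz <-]; exact: De.
have [_ [z Zz <-] xz] := inf_adherent D0 D_lb.
exists z => // z' Zz'; rewrite (le_trans (ltW xz))//.
have xz' : inf D <= rnorm (x - z') by apply: ge_inf; [exact: D_lb.2|exists z'].
by rewrite mulr_natl mulr2n lerD.
Qed.

(** The almost orthogonal unit vector has the explicit form a (x - z), with z
in Z, so that its membership in subspaces and its image under operators can be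
read off from x. *)
Lemma riesz_lemma Z x : closed_subspace Z -> ~ Z x ->
  exists (a : R[i]) z, [/\ a != 0, Z z, rnorm (a *: (x - z)) = 1 &
    forall z', Z z' -> 2^-1 <= rnorm (a *: (x - z) - z')].
Proof.
move=> sZ nZx; have [z Zz xz] := almost_nearest x sZ.
have xz0 : x - z != 0 by apply: contra_notN nZx => /eqP/subr0_eq->.
have r0 := rnorm_gt0 xz0; set r := rnorm (x - z) in xz r0.
have rC0 : r%:C != 0 by rewrite gt_eqF// ltcR.
exists (r^-1)%:C, z; split=> //.
- by rewrite fmorphV invr_eq0.
- by rewrite rnormZr ?invr_ge0 ?(ltW r0)// mulVf// gt_eqF.
move=> z' Zz'.
have -> : (r^-1)%:C *: (x - z) - z' = (r^-1)%:C *: (x - (z + r%:C *: z')).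
  rewrite opprD addrA [in RHS]scalerBr scalerA -rmorphM mulVf ?gt_eqF//.
  by rewrite scale1r.
rewrite rnormZr ?invr_ge0 ?(ltW r0)// ler_pdivlMl// mulrC ler_pdivrMl//.
by apply: xz; apply: closed_subspaceD => //; exact: closed_subspaceZ.
Qed.

(** A bounded sequence whose image under B converges clusters, for
u n = C (B (u n)) - (C B - 1) (u n): the first term converges and the second one
clusters. *)
Lemma essential_left_inverse_cluster B C (r : R) (u : nat -> X) y :
  C * B - 1 \in compact_op -> (forall n, rnorm (u n) <= r) ->
  (forall e : R, 0 < e -> exists m,
    forall n, (m <= n)%N -> rnorm (y - B (u n)) < e) ->
  exists2 x, B x = y & forall (e : R) m, 0 < e ->
    exists2 n, (m <= n)%N & rnorm (x - u n) < e.
Proof.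
move=> CB ur uy; have [w wu] := compact_op_seq_cluster CB ur.
have [c c0 Cc] := bop_rbound C.
have ux (e : R) m : 0 < e ->
    exists2 n, (m <= n)%N & rnorm (C y - w - u n) < e.
  move=> e0; have e20 : 0 < e / 2 by lra.
  have [k yk] := uy (e / 2 / c) (divr_gt0 e20 c0).
  have [n mkn wn] := wu (e / 2) (maxn m k) e20; move: mkn.
  rewrite geq_max => /andP[mn kn]; exists n => //.
  have -> : C y - w - u n = C (y - B (u n)) - (w - (C * B - 1) (u n)).
    rewrite bopDE bopME bopNE bop1E linearB /= !opprB.
    by rewrite -!addrA; congr (_ + _); rewrite addKr addrC.
  rewrite (le_lt_trans (rnormD _ _))// rnormN [e]splitr ltrD//.
  by rewrite (le_lt_trans (Cc _))// mulrC -ltr_pdivlMr// yk.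
exists (C y - w) => //; apply: bop_lim => e e0.
have [k yk] := uy e e0; have [n kn xn] := ux e k e0.
by exists (u n) => //; exact: yk.
Qed.

(** Otherwise the Riesz lemma for the kernel Z of B in N gives unit vectors of N
at distance at least 1/2 from Z whose images tend to 0.  They have a cluster
point, which is in Z. *)
Lemma bounded_lift B C N : C * B - 1 \in compact_op -> closed_subspace N ->
  exists2 c : R, 0 < c & forall x, N x ->
    exists x', [/\ N x', B x' = B x & rnorm x' <= c * rnorm (B x)].
Proof.
move=> CB sN; apply: contrapT => nlift.
pose Z := N `&` B @^-1` [set 0].
have sZ : closed_subspace Z.
  apply: closed_subspaceI => //.
  exact/closed_subspace_preimage/closed_subspace_set0.
have /choice[u uP] (n : nat) : exists u, [/\ N u, rnorm u = 1,
    rnorm (B u) < n.+1%:R^-1 & forall z, Z z -> 2^-1 <= rnorm (u - z)].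
  have n0 : 0 < n.+1%:R :> R by [].
  have [x Nx nx] : exists2 x, N x & forall x', N x' -> B x' = B x ->
      n.+1%:R * rnorm (B x) < rnorm x'.
    apply: contra_notP nlift => nn; exists n.+1%:R => // x Nx.
    apply: contra_notP nn => nn; exists x => // x' Nx' xx'.
    by rewrite ltNge; apply/negP => x'le; apply: nn; exists x'.
  have nZx : ~ Z x.
    move=> [_ Bx0]; have := nx 0; rewrite Bx0 linear0 rnorm0 mulr0 ltxx.
    by case: sN => _ N0 _ /(_ N0 erefl).
  have [a [z [a0 [Nz Bz] u1 uZ]]] := riesz_lemma sZ nZx.
  have Nxz : N (x - z) by exact: closed_subspaceB.
  have Bxz : B (x - z) = B x by rewrite linearB /= Bz subr0.
  exists (a *: (x - z)); split=> //; first exact: closed_subspaceZ.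
  rewrite -[ltRHS]mulr1 ltr_pdivlMl// -[ltRHS]u1 linearZ /= Bxz !rnormZ mulrCA.
  rewrite ltr_pM2l; [by apply: nx|].
  by rewrite -ltcR RRe_real ?normr_real// normr_gt0.
have [||x Bx xu] := @essential_left_inverse_cluster B C 1 u 0 CB.
- by move=> n; have [_ ->] := uP n.
- move=> e e0; exists (Num.truncn e^-1) => n en; rewrite sub0r rnormN.
  have [_ _ /lt_le_trans-> //] := uP n; rewrite invf_ple ?posrE// ltW//.
  by rewrite (lt_le_trans (Num.Theory.truncnS_gt _))// ler_nat.
- have [|n _ xn] := xu 2^-1 0%N; first by [].
  have Zx : Z x.
    split=> //; have [cN _ _] := sN; apply: (closed_rnormP N).1 => // e e0.
    by have [k _ xk] := xu e 0%N e0; exists (u k) => //; have [] := uP k.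
  by have [_ _ _ /(_ x Zx)] := uP n; rewrite rnormB leNgt xn.
Qed.

(** A limit of images is a limit of images of a bounded sequence by
[bounded_lift], and a cluster point of that sequence is a preimage. *)
Lemma closed_subspace_image B C N : C * B - 1 \in compact_op ->
  closed_subspace N -> closed_subspace (B @` N).
Proof.
move=> CB sN; have [cN N0 Nlin] := sN; split; last 2 first.
- by exists 0 => //; rewrite linear0.
- move=> a _ _ [x Nx <-] [y Ny <-].
  by exists (a *: x + y); [exact: Nlin|rewrite linearP].
have [c c0 lift] := bounded_lift CB sN.
apply/closed_rnormP => y yN.
have /choice[u uP] (n : nat) : exists u, [/\ N u,
    rnorm (y - B u) < n.+1%:R^-1 & rnorm u <= c * (rnorm y + 1)].
  have [|_ [x Nx <-] yx] := yN n.+1%:R^-1; first by rewrite invr_gt0.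
  have [x' [Nx' Bx' x'c]] := lift x Nx; exists x'; rewrite Bx'; split=> //.
  rewrite (le_trans x'c)// ler_wpM2l// ?(ltW c0)//.
  rewrite -[B x](subrK y) (le_trans (rnormD _ _))// addrC lerD2l rnormB.
  by rewrite (le_trans (ltW yx))// invf_le1// ler1n.
pose r := c * (rnorm y + 1).
have [||x Bx xu] := @essential_left_inverse_cluster B C r u y CB.
- by move=> n; have [_ _] := uP n; exact.
- move=> e e0; exists (Num.truncn e^-1) => n en.
  have [_ /lt_le_trans-> //] := uP n; rewrite invf_ple ?posrE// ltW//.
  by rewrite (lt_le_trans (Num.Theory.truncnS_gt _))// ler_nat.
- exists x => //; apply: (closed_rnormP N).1 => // e e0.
  by have [k _ xk] := xu e 0%N e0; exists (u k) => //; have [] := uP k.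
Qed.

(** [bounded_lift] on the whole space bounds the inverse map, in place of the open
mapping theorem. *)
Lemma bijective_invertible B C : C * B - 1 \in compact_op ->
  (forall x, B x = 0 -> x = 0) -> B @` setT = setT -> invertible B.
Proof.
move=> CB Binj Bsurj.
have [c c0 lift] := bounded_lift CB closed_subspaceT.
have /choice[g gK] (y : X) : exists x, B x = y.
  by have [x _ <-] : (B @` setT) y; [rewrite Bsurj|exists x].
have Bg x : g (B x) = x by apply/subr0_eq/Binj; rewrite linearB /= gK subrr.
have gb : g \in bounded_linear.
  rewrite unfold_in; apply/asboolP; split=> [a x y|].
    by rewrite -[RHS]Bg linearP /= !gK.
  exists c%:C => y; have [x' [_ Bx' x'c]] := lift (g y) I.
  have <- : x' = g y by rewrite -[x']Bg Bx' gK.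
  by rewrite !rnormE -rmorphM lecR (le_trans x'c)// gK.
by exists (Bop gb); split; apply: bop_ext => x; [exact: gK|exact: Bg].
Qed.

End Subspaces.

(** * Ascent and descent *)

Section RieszTheory.
Context {R : realType} {X : completeNormedModType R[i]}.
Implicit Types (x y z : X) (B C G Q K E : bop X) (M N Z : set X).

Lemma invariantX B N n : Defs.invariant B N -> Defs.invariant (B ^+ n) N.
Proof.
move=> BN; elim: n => [|n IHn] _ [x Nx <-]; first by rewrite expr0 bop1E.
by rewrite exprSr bopME; apply: IHn; exists (B x) => //; apply: BN; exists x.
Qed.

Lemma essential_left_inverseX B C n :
  C * B - 1 \in compact_op -> C ^+ n * B ^+ n - 1 \in compact_op.
Proof.
move=> CB; elim: n => [|n IHn]; first by rewrite !expr0 mulr1 subrr rpred0.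
have -> : C ^+ n.+1 * B ^+ n.+1 - 1 =
    C ^+ n * (C * B - 1) * B ^+ n + (C ^+ n * B ^+ n - 1).
  by rewrite exprSr exprS mulrBr mulrBl mulr1 addrA subrK !mulrA.
by apply: rpredD => //; apply: compact_opMr; exact: compact_opMl.
Qed.

(** The essential norm is at most 1/8; any bound less than 1/4 would suit
[compact_plus_small_no_separated]. *)
Definition compact_plus_small Q := exists K E,
  [/\ K \in compact_op, forall x, rnorm (E x) <= 8^-1 * rnorm x & Q = K + E].

(** The compact part brings two images within 1/4 of each other, and the small part
moves them apart by at most 1/4 more. *)
Lemma compact_plus_small_no_separated Q (u : nat -> X) : compact_plus_small Q ->
  (forall n, rnorm (u n) = 1) ->
  ~ forall m n, (m < n)%N -> 2^-1 <= rnorm (Q (u m) - Q (u n)).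
Proof.
move=> [K [E [Kc Es ->]]] u1 sep.
have [|w wu] := compact_op_seq_cluster (r := 1) Kc (u := u).
  by move=> n; rewrite u1.
have e0 : 0 < 8^-1 :> R by lra.
have [m _ wm] := wu 8^-1 0%N e0; have [n mn wn] := wu 8^-1 m.+1 e0.
have := sep m n mn; rewrite !bopDE opprD addrACA leNgt => /negP; apply.
have := rnormD (K (u m) - K (u n)) (E (u m) - E (u n)).
have := rnorm_dist (K (u m)) w (K (u n)); rewrite (rnormB (K (u m)) w).
have := rnormD (E (u m)) (- E (u n)); rewrite rnormN.
have := Es (u m); have := Es (u n); rewrite !u1; lra.
Qed.

(** In this section 1 - Q = B G with G commuting with B, so that Q is the identity
modulo the range of B on every subspace invariant under B and G. *)
Section AscentDescent.
Variables B C G Q : bop X.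
Hypotheses (CB : C * B - 1 \in compact_op) (BG : B * G = 1 - Q)
  (GB : G * B = B * G) (Qsmall : compact_plus_small Q).
Variable N : set X.
Hypotheses (sN : closed_subspace N)
  (BN : Defs.invariant B N) (GN : Defs.invariant G N).

Let QE x : Q x = x - B (G x).
Proof. by rewrite -bopME BG bopDE bopNE bop1E opprB addrC subrK. Qed.

Let GBn n : G * B ^+ n = B ^+ n * G.
Proof. by apply: (@commrX _ G B n); rewrite /GRing.comm GB. Qed.

(** If B is injective but not onto N, the closed subspaces B^n N decrease strictly.
Unit vectors u n of B^n N almost orthogonal to B^(n+1) N have images under Q at
distance at least 1/2 from each other, for Q (u m) is in u m + B^(m+1) N and, if
m < n, Q (u n) is in B^(m+1) N. *)
Lemma injective_surjective :
  (forall x, N x -> B x = 0 -> x = 0) -> B @` N = N.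
Proof.
move=> Binj; apply/seteqP; split; first exact: BN.
apply: contrapT => /existsNP[y /not_implyP[Ny nBNy]].
pose V n := (B ^+ n) @` N.
have sV n : closed_subspace (V n).
  exact: closed_subspace_image (essential_left_inverseX n CB) sN.
have Vle m n : (m <= n)%N -> V n `<=` V m.
  move=> mn _ [x Nx <-]; rewrite -(subnKC mn) exprD bopME.
  by exists ((B ^+ (n - m)) x) => //; apply: (invariantX BN); exists x.
have VBG n x : V n x -> V n.+1 (B (G x)).
  move=> [z Nz <-]; exists (G z); first by apply: GN; exists z.
  by rewrite exprS -!bopME -mulrA -GBn.
have Binjn n x : N x -> (B ^+ n) x = 0 -> x = 0.
  elim: n x => [x _|n IHn x Nx]; first by rewrite expr0 bop1E.
  rewrite exprSr bopME => /IHn Bx0; apply: Binj => //; apply: Bx0.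
  by apply: BN; exists x.
have /choice[u uP] (n : nat) : exists u, [/\ V n u, rnorm u = 1 &
    forall z, V n.+1 z -> 2^-1 <= rnorm (u - z)].
  have nVy : ~ V n.+1 ((B ^+ n) y).
    move=> [z Nz]; rewrite exprSr bopME => /eqP.
    have NBzy : N (B z - y).
      by apply: closed_subspaceB => //; apply: BN; exists z.
    rewrite -subr_eq0 -linearB => /eqP/(Binjn _ _ NBzy)/subr0_eq Bzy.
    by apply: nBNy; exists z.
  have [a [z [_ Vz u1 uV]]] := riesz_lemma (sV n.+1) nVy.
  exists (a *: ((B ^+ n) y - z)); split=> //; apply: closed_subspaceZ (sV n) _.
  apply: closed_subspaceB (sV n) _ _; first by exists y.
  exact: Vle Vz.
apply: (@compact_plus_small_no_separated _ u Qsmall) => [n|m n mn].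
  by have [] := uP n.
have [Vm _ um] := uP m; have [Vn _ _] := uP n.
rewrite {1}QE -addrA -opprD; apply: um.
apply: closed_subspaceD => //; first exact: VBG.
rewrite QE; apply: (Vle m.+1 n mn); apply: closed_subspaceB => //.
by apply: (Vle n n.+1) => //; exact: VBG.
Qed.

(** The dual argument: if B is onto N but not injective, the kernels of the powers
B^n in N increase strictly, as one sees by lifting a kernel vector repeatedly;
the unit vectors are chosen in the kernel of B^(n+1), almost orthogonal to that
of B^n. *)
Lemma surjective_injective :
  B @` N = N -> forall x, N x -> B x = 0 -> x = 0.
Proof.
move=> Bsurj x0 Nx0 Bx0; apply: contrapT => x0_neq0.
pose W n := N `&` (B ^+ n) @^-1` [set 0].
have sW n : closed_subspace (W n).
  apply: closed_subspaceI => //.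
  exact/closed_subspace_preimage/closed_subspace_set0.
have Wle m n : (m <= n)%N -> W m `<=` W n.
  move=> mn x [Nx /= Bx]; split=> //=.
  by rewrite -(subnK mn) exprD bopME Bx linear0.
have WBG n x : W n.+1 x -> W n (B (G x)).
  move=> [Nx /= Bx]; have NGx : N (G x) by apply: GN; exists x.
  split=> /=; first by apply: BN; exists (G x).
  by rewrite -!bopME -exprSr -GBn bopME Bx linear0.
have y_ex (n : nat) : exists2 y, N y & (B ^+ n) y = x0.
  elim: n => [|n [y Ny <-]]; first by exists x0; rewrite ?expr0.
  move: (Ny); rewrite -{1}Bsurj => -[z Nz <-]; exists z => //.
  by rewrite exprSr bopME.
have /choice[u uP] (n : nat) : exists u, [/\ W n.+1 u, rnorm u = 1 &
    forall z, W n z -> 2^-1 <= rnorm (u - z)].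
  have [y Ny By] := y_ex n.
  have nWy : ~ W n y by move=> [_ /=]; rewrite By.
  have [a [z [_ Wz u1 uW]]] := riesz_lemma (sW n) nWy.
  exists (a *: (y - z)); split=> //; apply: closed_subspaceZ (sW n.+1) _.
  apply: closed_subspaceB (sW n.+1) _ _; last exact: Wle Wz.
  by split=> //=; rewrite exprS bopME By.
apply: (@compact_plus_small_no_separated _ u Qsmall) => [n|m n mn].
  by have [] := uP n.
have [Wm _ _] := uP m; have [Wn _ un] := uP n.
rewrite rnormB {1}QE -addrA -opprD; apply: un.
apply: closed_subspaceD => //; first exact: WBG.
rewrite QE; apply: (Wle m.+1 n mn); apply: closed_subspaceB => //.
by apply: (Wle m m.+1) => //; exact: WBG.
Qed.

End AscentDescent.
End RieszTheory.

(** * Polynomials in an operator *)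

Section Polynomials.
Context {R : realType} {X : completeNormedModType R[i]}.
Implicit Types (S T U : bop X) (p q : {poly R[i]}) (N : set X).

Lemma bop_scaleAl (a : R[i]) S U : (a *: S) * U = a *: (S * U).
Proof. exact: bop_ext. Qed.

Lemma bop_scaleAr (a : R[i]) S U : S * (a *: U) = a *: (S * U).
Proof. by apply: bop_ext => x; rewrite /= linearZ. Qed.

Lemma compact_opZ (a : R[i]) S : S \in compact_op -> a *: S \in compact_op.
Proof. by move=> Sc; rewrite -[S]mul1r -bop_scaleAl compact_opMl. Qed.

Lemma poly_bop_widen p T n : (size p <= n)%N ->
  poly_bop p T = \sum_(i < n) p`_i *: T ^+ i.
Proof.
move=> pn; rewrite [LHS](big_ord_widen n (fun i => p`_i *: T ^+ i) pn).
rewrite big_mkcond; apply: eq_bigr => i _; case: ltnP => // ip.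
by rewrite nth_default// scale0r.
Qed.

Lemma poly_bopD p q T : poly_bop (p + q) T = poly_bop p T + poly_bop q T.
Proof.
rewrite (poly_bop_widen T (size_polyD p q)).
rewrite (poly_bop_widen T (leq_maxl (size p) (size q))).
rewrite (poly_bop_widen T (leq_maxr (size p) (size q))) -big_split.
by apply: eq_bigr => i _; rewrite coefD scalerDl.
Qed.

Lemma poly_bopZ (a : R[i]) p T : poly_bop (a *: p) T = a *: poly_bop p T.
Proof.
rewrite (poly_bop_widen T (size_scale_leq a p)) scaler_sumr.
by apply: eq_bigr => i _; rewrite coefZ scalerA.
Qed.

Lemma poly_bop1 T : poly_bop 1 T = 1.
Proof.
rewrite (@poly_bop_widen 1 T 1) ?size_poly1// big_ord1 coef1 expr0.
by rewrite scale1r.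
Qed.

Lemma poly_bopMX p T : poly_bop (p * 'X) T = poly_bop p T * T.
Proof.
rewrite (@poly_bop_widen _ T (size p).+1); last first.
  by rewrite (leq_trans (size_polyMleq _ _))// size_polyX addn2.
rewrite big_ord_recl coefMX scale0r add0r mulr_suml.
by apply: eq_bigr => i _; rewrite coefMX bop_scaleAl -exprSr.
Qed.

Lemma poly_bopC (a : R[i]) T : poly_bop a%:P T = a *: (1 : bop X).
Proof. by rewrite -[a%:P]mulr1 mul_polyC poly_bopZ poly_bop1. Qed.

Lemma poly_bopM p q T : poly_bop (p * q) T = poly_bop p T * poly_bop q T.
Proof.
elim/poly_ind: q => [|q a IHq].
  by rewrite mulr0 -(scale0r 0) poly_bopZ scale0r mulr0.
rewrite mulrDr mulrA !poly_bopD !poly_bopMX IHq mulrDr mulrA; congr (_ + _).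
by rewrite mulrC mul_polyC poly_bopZ poly_bopC bop_scaleAr mulr1.
Qed.

Lemma poly_bopX_n p T n : poly_bop (p ^+ n) T = poly_bop p T ^+ n.
Proof.
elim: n => [|n IHn]; first by rewrite !expr0 poly_bop1.
by rewrite !exprS poly_bopM IHn.
Qed.

Lemma poly_bopXsubC (a : R[i]) T :
  poly_bop ('X - a%:P) T = T - a *: (1 : bop X).
Proof.
rewrite -polyCN poly_bopD poly_bopC scaleNr -['X]mul1r poly_bopMX poly_bop1.
by rewrite mul1r.
Qed.

Lemma poly_bop_comm p q T :
  poly_bop p T * poly_bop q T = poly_bop q T * poly_bop p T.
Proof. by rewrite -!poly_bopM mulrC. Qed.

Lemma poly_bop_invariant p T N : closed_subspace N ->
  Defs.invariant T N -> Defs.invariant (poly_bop p T) N.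
Proof.
move=> sN TN; elim/poly_ind: p => [|p a IHp] _ [x Nx <-].
  by rewrite -(scale0r 0) poly_bopZ scale0r; case: sN.
rewrite poly_bopD poly_bopMX poly_bopC bopDE bopME bopZE bop1E.
apply: closed_subspaceD => //; last exact: closed_subspaceZ.
by apply: IHp; exists (T x) => //; apply: TN; exists x.
Qed.

End Polynomials.

(** * Polynomially Riesz operators outside the essential spectrum *)

Section RieszOperators.
Context {R : realType} {X : completeNormedModType R[i]}.
Implicit Types (S T U B C : bop X) (p q : {poly R[i]}) (l : R[i]).

Lemma op_norm_le T x : rnorm (T x) <= op_norm T * rnorm x.
Proof.
have [->|x0] := eqVneq x 0; first by rewrite linear0 rnorm0 mulr0.
have r0 := rnorm_gt0 x0; set r := rnorm x in r0 *.
have rC0 : r%:C != 0 by rewrite gt_eqF// ltcR.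
rewrite mulrC -ler_pdivrMl// -rnormZr ?invr_ge0 ?(ltW r0)// -linearZ.
have [M M0 TM] := bop_rbound T.
apply: ub_le_sup; last first.
  exists ((r^-1)%:C *: x) => //=.
  by rewrite -[1]/(1%:C) le_rnorm rnormZr ?invr_ge0 ?(ltW r0)// mulVf// gt_eqF.
exists M => _ [y /= y1 <-]; rewrite -[1]/(1%:C) le_rnorm in y1.
by rewrite (le_trans (TM y))// ler_piMr// ltW.
Qed.

Lemma calkin_norm_lt (a : calkin X) (e : R) : calkin_norm a < e ->
  exists2 U, calkin_pi U = a & op_norm U < e.
Proof.
move=> ae; apply: contrapT => nU; move: ae; rewrite ltNge => /negP; apply.
apply: lb_le_inf.
  by exists (op_norm (calkin_repr a)), (calkin_repr a); rewrite /= ?calkin_reprK.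
move=> _ [U /= Ua <-]; rewrite leNgt; apply/negP => Ue.
by apply: nU; exists U.
Qed.

Lemma riesz_small S (e : R) : riesz S -> 0 < e ->
  exists n U, [/\ (0 < n)%N, calkin_pi U = calkin_pi S ^+ n &
    forall x, rnorm (U x) <= e ^+ n * rnorm x].
Proof.
move=> /cvgrPdist_lt rS e0; have [m _ Sm] := rS e e0.
have := Sm m.+1 (leqnSn m); rewrite sub0r normrN ger0_norm ?powR_ge0// => Se.
exists m.+1; suff /calkin_norm_lt[U US Ue] :
    calkin_norm (calkin_pi S ^+ m.+1) < e ^+ m.+1.
  exists U; split=> // x; rewrite (le_trans (op_norm_le _ _))//.
  by rewrite ler_wpM2r ?rnorm_ge0// ltW.
set a := calkin_norm _ in Se *.
have [a0|a0] := leP 0 a; last by rewrite (lt_trans a0)// exprn_gt0.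
have -> : a = (a `^ m.+1%:R^-1) ^+ m.+1.
  by rewrite -powR_mulrn ?powR_ge0// -powRrM mulVf// powRr1.
by rewrite ltrXn2r// ?powR_ge0// ltW.
Qed.

Lemma essential_spectrumPn T l : ~ essential_spectrum T l ->
  exists C, calkin_pi C * calkin_pi (T - l *: (1 : bop X)) = 1 /\
            calkin_pi (T - l *: (1 : bop X)) * calkin_pi C = 1.
Proof.
move=> /contrapT[b [Bb bB]]; exists (calkin_repr b).
by rewrite calkin_reprK raddfB.
Qed.

Lemma factor_root p l : p != 0 ->
  exists k q, [/\ q.[l] != 0 & p = ('X - l%:P) ^+ k * q].
Proof.
move=> p0; have [k [q]] := multiplicity_XsubC p l; rewrite p0 /= => ql ->.
by exists k, q; rewrite mulrC.
Qed.

(** Write p = (X - l)^k q with q(l) <> 0, and r = q / q(l).  With C the inverse of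
B = T - l modulo the compact operators, r(T) is D p(T) modulo the compact
operators, where D = C^k / q(l).  Since D commutes with p(T) in the Calkin
algebra, r(T)^n is D^n p(T)^n there; the growth of D^n is geometric, and
p(T)^n has representatives that are smaller than any geometric sequence. *)
Lemma polynomially_riesz_compact_plus_small T l :
  polynomially_riesz T -> ~ essential_spectrum T l ->
  exists C Q g, [/\ C * (T - l *: (1 : bop X)) - 1 \in compact_op,
    compact_plus_small Q &
    (T - l *: (1 : bop X)) * poly_bop g T = 1 - Q].
Proof.
move=> [p [p0 rp]] /essential_spectrumPn[C].
set B := T - l *: (1 : bop X) => -[CB BC].
have BE : B = poly_bop ('X - l%:P) T by rewrite poly_bopXsubC.
have CBc : C * B - 1 \in compact_op.
  by apply/calkin_piE; rewrite rmorphM rmorph1.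
have [k [q [ql pE]]] := factor_root l p0.
set S := poly_bop p T in rp.
have SE : S = B ^+ k * poly_bop q T by rewrite /S pE poly_bopM poly_bopX_n -BE.
pose r := q.[l]^-1 *: q; pose P := poly_bop r T; pose D := q.[l]^-1 *: C ^+ k.
have cCS : GRing.comm (calkin_pi C) (calkin_pi S).
  have BS : calkin_pi S * calkin_pi B = calkin_pi B * calkin_pi S.
    by rewrite -!rmorphM BE poly_bop_comm.
  rewrite /GRing.comm -[calkin_pi S in LHS]mulr1 -BC !mulrA.
  by rewrite -(mulrA _ _ (calkin_pi B)) BS mulrA CB mul1r.
have cDS : GRing.comm (calkin_pi D) (calkin_pi S).
  rewrite /GRing.comm -!rmorphM; apply/calkin_piE.
  rewrite /D bop_scaleAl bop_scaleAr -scalerBr; apply: compact_opZ.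
  apply/calkin_piE; rewrite !rmorphM rmorphXn.
  exact/commr_sym/commrX/commr_sym.
have PE : calkin_pi P = calkin_pi D * calkin_pi S.
  rewrite -rmorphM; apply/calkin_piE; rewrite -opprB rpredN /P /D /r SE.
  rewrite poly_bopZ bop_scaleAl -scalerBr mulrA -{2}[poly_bop q T]mul1r -mulrBl.
  by apply/compact_opZ/compact_opMr/essential_left_inverseX.
have [m m0 Dm] := bop_rbound D.
(* as D ^+ n is bounded by m ^+ n, this makes D ^+ n * U bounded by 8 ^- n *)
have [|n [U [n0 US Ue]]] := riesz_small (e := 8^-1 / m) rp.
  by rewrite divr_gt0.
have PUc : P ^+ n - D ^+ n * U \in compact_op.
  by apply/calkin_piE; rewrite rmorphM !rmorphXn /= US PE exprMn_comm.
have Dn x : rnorm ((D ^+ n) x) <= m ^+ n * rnorm x.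
  elim: (n) x => [|j IHj] x; first by rewrite !expr0 mul1r.
  rewrite !exprS bopME (le_trans (Dm _))// -mulrA ler_wpM2l//; exact: ltW.
have /factor_theorem[g gE] : root (1 - r ^+ n) l.
  by rewrite /root !hornerE mulVf// expr1n subrr.
exists C, (P ^+ n), g; split=> //.
  exists (P ^+ n - D ^+ n * U), (D ^+ n * U); split=> //; last by rewrite subrK.
  move=> x; rewrite bopME (le_trans (Dn _))//.
  rewrite (@le_trans _ _ (m ^+ n * ((8^-1 / m) ^+ n * rnorm x)))//.
    by rewrite ler_wpM2l// exprn_ge0// ltW.
  rewrite mulrA -exprMn mulrCA divff ?gt_eqF// mulr1 ler_wpM2r ?rnorm_ge0//.
  by rewrite -[leRHS]expr1 ler_wiXn2l//; lra.
have <- : poly_bop (1 - r ^+ n) T = 1 - P ^+ n.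
  by rewrite poly_bopD poly_bop1 -scaleN1r poly_bopZ scaleN1r poly_bopX_n.
by rewrite gE mulrC poly_bopM -BE.
Qed.

End RieszOperators.

(** * Maximal chains of closed subspaces *)

Section MaximalChains.
Context {R : realType} {X : completeNormedModType R[i]}.
Implicit Types (x y : X) (T B C : bop X) (M N S : set X) (F K : set (set X)).

Section Members.
Variable K : set (set X).
Hypothesis maxK : maximal_subspace_chain K.

Let subK M : K M -> closed_subspace M.
Proof. by case: maxK => -[sK _] _; exact: sK. Qed.

Lemma comparable_chain M : closed_subspace M ->
  (forall N, K N -> N `<=` M \/ M `<=` N) -> K M.
Proof.
case: maxK => -[sK totK] Kmax sM cmp.
have <- : K `|` [set M] = K; last by right.
apply: Kmax; last by move=> N KN; left.
split=> [N [/sK//|->//]|N P [KN|->] [KP|->]].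
- exact: totK.
- exact: cmp.
- by rewrite orC; exact: cmp.
- by left.
Qed.

Lemma chain_setT : K setT.
Proof. by apply: comparable_chain; [exact: closed_subspaceT|left]. Qed.

Lemma chain_bigcap F : F `<=` K -> K (\bigcap_(N in F) N).
Proof.
move=> FK; apply: comparable_chain => [|N KN].
  by apply: closed_subspace_bigI => N /FK/subK.
have [[P FP PN]|nPN] := pselect (exists2 P, F P & P `<=` N).
  by right=> x Fx; apply: PN; exact: Fx.
left=> x Nx P FP; case: maxK => -[_ totK] _.
by have [PN|] := totK P N (FK _ FP) KN; [case: nPN; exists P|exact].
Qed.

Lemma chain_cases M N : K M -> K N -> N `<` M \/ M `<=` N.
Proof.
case: maxK => -[_ totK] _ KM KN.
have [|nMN] := pselect (M `<=` N); first by right.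
by left; have [//|NM] := totK M N KM KN.
Qed.

Lemma sub_predecessor M N : K N -> N `<` M -> N `<=` predecessor K M.
Proof. by move=> KN NM x Nx D [_]; apply; exists N. Qed.

Lemma chain_predecessor M : K M -> K (predecessor K M).
Proof.
move=> KM; apply: comparable_chain => [|N KN]; first exact: closed_span_subspace.
have [NM|MN] := chain_cases KM KN; first by left; exact: sub_predecessor.
by right; apply: subset_trans MN; exact: predecessor_sub (subK KM).
Qed.

(** The closed span on the right is comparable with all members of the chain,
hence is a member, and it is not strictly below M since it contains x.  Taking
the closed span spares the proof that the sum of a closed subspace and a line is
closed. *)
Lemma chain_gap M x : K M -> M x -> ~ predecessor K M x ->
  M = closed_span (predecessor K M `|` [set x]).
Proof.
move=> KM Mx nPx; set Y := closed_span _.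
have sMY : Y `<=` M.
  apply: smallest_sub; first exact: subK.
  by move=> y [/(predecessor_sub (subK KM))|->].
have Px : predecessor K M `|` [set x] `<=` Y by exact: sub_smallest.
have KY : K Y.
  apply: comparable_chain => [|N KN]; first exact: closed_span_subspace.
  have [NM|MN] := chain_cases KM KN; last by right; exact: subset_trans MN.
  by left=> y Ny; apply: Px; left; exact: sub_predecessor Ny.
apply/seteqP; split=> //; apply: contrapT => nMY; apply: nPx.
by apply: (@sub_predecessor M Y) => //; apply: Px; right.
Qed.

(** T - l maps both the predecessor and x into the predecessor, and the preimage
of the predecessor is a closed subspace. *)
Lemma diagonal_coefficient_eigenvector T l M x :
  K M -> Defs.invariant T (predecessor K M) ->
  M x -> ~ predecessor K M x -> T x = l *: x -> diagonal_coefficient T K M l.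
Proof.
move=> KM TP Mx nPx Tx y My; have sP : closed_subspace (predecessor K M).
  exact: closed_span_subspace.
have BE z : (T - l *: (1 : bop X)) z = T z - l *: z by [].
rewrite -BE; suff : closed_span (predecessor K M `|` [set x]) `<=`
  (T - l *: (1 : bop X)) @^-1` predecessor K M by rewrite -chain_gap//; exact.
apply: smallest_sub; first exact: closed_subspace_preimage.
move=> z Yz; change (predecessor K M (T z - l *: z)); case: Yz => [Pz|->].
  apply: closed_subspaceB sP _ (closed_subspaceZ _ sP Pz).
  by apply: TP; exists z.
by rewrite Tx subrr; case: sP.
Qed.

End Members.

(** Nested sets form a filter base; a cluster point in S of the filter generated by
their traces on S is in all of them. *)
Lemma chain_bigcap_compact F S : compact S -> F !=set0 ->
  total_on F (fun M N => M `<=` N) -> (forall N, F N -> closed N) ->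
  (forall N, F N -> N `&` S !=set0) -> \bigcap_(N in F) N `&` S !=set0.
Proof.
move=> cS [N0 FN0] totF cF FS.
have pG : ProperFilter (filter_from F (fun N => N `&` S)).
  apply: filter_from_proper => //.
  apply: filter_from_filter; first by exists N0.
  move=> M N FM FN; have [MN|NM] := totF M N FM FN.
    by exists M => // x [Mx Sx]; do !split=> //; exact: MN.
  by exists N => // x [Nx Sx]; do !split=> //; exact: NM.
have [|w [Sw Fw]] := cS _ pG; first by exists N0 => // x [].
exists w; split=> // N FN; apply: cF => // A wA.
have [|x [[Nx _] Ax]] := Fw (N `&` S) A _ wA; first by exists N.
by exists x.
Qed.

(** On the kernel of B, the compact operator C B - 1 is - 1. *)
Lemma compact_kernel_sphere B C : C * B - 1 \in compact_op ->
  compact [set x | B x = 0 /\ rnorm x = 1].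
Proof.
move=> /compact_opP[L cL CBL].
apply: (@subclosed_compact _ _ (-%R @` L)).
- apply/closed_rnormP => x xA; split.
    apply: bop_lim => e e0; have [y [By _] xy] := xA e e0.
    by exists y => //; rewrite By subrr rnorm0.
  apply/eqP; rewrite eq_le; apply/andP; split; apply/ler_addgt0Pl => e e0.
    have [y [_ y1] xy] := xA e e0.
    by rewrite -y1 -{1}[x](subrK y) (le_trans (rnormD _ _))// lerD2r ltW.
  have [y [_ y1] xy] := xA e e0.
  rewrite -{1}y1 -{1}[y](subrK x) (le_trans (rnormD _ _))// lerD2r rnormB.
  exact: ltW.
- apply: continuous_compact cL; apply: continuous_subspaceT => x.
  exact: opp_continuous.
- move=> x [Bx x1]; exists (- x); last by rewrite opprK.
  have <- : (C * B - 1) x = - x.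
    by rewrite bopDE bopME bopNE bop1E Bx linear0 sub0r.
  by apply: CBL; rewrite -[1]/(1%:C) le_rnorm x1.
Qed.

End MaximalChains.

(** * Diagonal coefficients and the spectrum *)

Section DiagonalCoefficients.
Context {R : realType} {X : completeNormedModType R[i]}.
Variables (T : bop X) (K : set (set X)) (l : R[i]).
Hypotheses (pT : polynomially_riesz T) (TK : triangularizing_chain T K)
  (Tl : ~ essential_spectrum T l).

Let B : bop X := T - l *: (1 : bop X).

Let subK M : K M -> closed_subspace M.
Proof. by case: TK => -[[sK _] _] _; exact: sK. Qed.

Let BE x : B x = T x - l *: x. Proof. by []. Qed.

Let BK M : K M -> Defs.invariant B M.
Proof.
move=> KM _ [x Mx <-]; rewrite BE; have sM := subK KM.
apply: closed_subspaceB => //; last exact: closed_subspaceZ.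
by case: TK => _ TM; apply: (TM M KM); exists x.
Qed.

Lemma chain_injective_surjective M : K M ->
  ((forall x, M x -> B x = 0 -> x = 0) -> B @` M = M) /\
  (B @` M = M -> forall x, M x -> B x = 0 -> x = 0).
Proof.
move=> KM.
have [C [Q [g [CB Qs Bg]]]] := polynomially_riesz_compact_plus_small pT Tl.
have sM := subK KM.
have gB : poly_bop g T * B = B * poly_bop g T.
  by rewrite /B -poly_bopXsubC poly_bop_comm.
have gM : Defs.invariant (poly_bop g T) M.
  by apply: poly_bop_invariant => //; case: TK => _; exact.
split; first exact: (injective_surjective CB Bg gB Qs sM (BK KM) gM).
exact: (surjective_injective Bg gB Qs sM (BK KM) gM).
Qed.

(** B maps M into its predecessor, so it would map M onto a proper subspace if it
were invertible, while injectivity makes it map M onto M. *)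
Lemma diagonal_coefficient_spectrum :
  diagonal_coefficients T K l -> spectrum T l.
Proof.
move=> [M [KM nMP Ml]] [B' [_ B'B]]; apply: nMP; apply/seteqP; split.
  have [Bsurj _] := chain_injective_surjective KM.
  move=> x Mx; have [y My <-] : (B @` M) x.
    rewrite Bsurj// => y _ By.
    by rewrite -[y](bop1E y) -B'B bopME -/B By linear0.
  by rewrite BE; exact: Ml.
exact: predecessor_sub (subK KM).
Qed.

(** The diagonal coefficient l occurs at the smallest member M of the chain on which
B is not injective; M exists because the unit sphere S of the kernel of B is
compact. *)
Lemma spectrum_diagonal_coefficient :
  spectrum T l -> diagonal_coefficients T K l.
Proof.
case: (TK) => maxK TM nBinv.
have [C [Q [g [CB _ _]]]] := polynomially_riesz_compact_plus_small pT Tl.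
pose S := [set x | B x = 0 /\ rnorm x = 1].
have S_ex (M : set X) : closed_subspace M -> ~ (M `&` S !=set0) ->
    forall x, M x -> B x = 0 -> x = 0.
  move=> sM nMS x Mx Bx; apply: contra_notP nMS => /eqP x0.
  have r0 := rnorm_gt0 x0; exists (((rnorm x)^-1)%:C *: x); split.
    exact: closed_subspaceZ.
  split; first by rewrite bop_linearZ Bx scaler0.
  by rewrite rnormZr ?invr_ge0 ?(ltW r0)// mulVf// gt_eqF.
pose F := [set N | K N /\ N `&` S !=set0].
have FK : F `<=` K by move=> N [].
pose M := \bigcap_(N in F) N.
have KM : K M by exact: chain_bigcap.
have [x [Mx [Bx x1]]] : M `&` S !=set0.
  apply: chain_bigcap_compact.
  - exact: compact_kernel_sphere CB.
  - exists setT; split; first exact: chain_setT.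
    apply: contra_notP nBinv => nTS.
    have Binj := S_ex _ closed_subspaceT nTS.
    apply: (bijective_invertible CB) => [x|]; first exact: Binj.
    by have [+ _] := chain_injective_surjective (chain_setT maxK); exact.
  - by case: maxK => -[_ totK] _ N P /FK KN /FK KP; exact: totK.
  - by move=> N /FK/subK[].
  - by move=> N [].
have x0 : x <> 0.
  move=> x0; move: x1; rewrite x0 rnorm0 => /eqP.
  by rewrite eq_sym oner_eq0.
(* by definition of M, the members strictly below M do not meet S *)
have below N : K N -> N `<` M -> N `<=` B @` M.
  move=> KN [NM nMN]; have [Bsurj _] := chain_injective_surjective KN.
  rewrite -{1}Bsurj; first exact: image_subset.
  apply: S_ex; first exact: subK.
  by move=> NS; apply: nMN => y My; exact: My.
have nPx : ~ predecessor K M x.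
  move=> Px; have PM : predecessor K M = M.
    apply: contrapT => PM; have PltM : predecessor K M `<` M.
      split; first exact: predecessor_sub (subK KM).
      move=> MP; apply: PM; apply/seteqP; split=> //.
      exact: predecessor_sub (subK KM).
    case: PltM => _; apply; apply: bigcap_inf; split; last by exists x.
    exact: chain_predecessor.
  have [_ Binj] := chain_injective_surjective KM.
  apply: x0; apply: Binj => //; apply/seteqP; split; first exact: BK.
  rewrite -{1}PM; apply: smallest_sub.
    exact: closed_subspace_image CB (subK KM).
  by move=> y [N [KN NM] Ny]; exact: below Ny.
exists M; split=> //; first by move=> MP; apply: nPx; rewrite -MP.
apply: (diagonal_coefficient_eigenvector maxK KM _ Mx nPx).
  by apply: TM; exact: chain_predecessor.
by apply/subr0_eq; rewrite -BE.
Qed.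

End DiagonalCoefficients.

Lemma essential_spectrum_sub (R : realType) (X : completeNormedModType R[i])
  (T : bop X) : essential_spectrum T `<=` spectrum T.
Proof.
move=> l; apply: contra_not => -[S [TS ST]]; exists (calkin_pi S).
by rewrite -raddfB -!rmorphM TS ST rmorph1.
Qed.

Theorem corollary3p6 (R : realType) (X : completeNormedModType R[i])
    (T : bop X) (hT : triangularizable T) (hpT : polynomially_riesz T)
    (C : set (set X)) (hC : triangularizing_chain T C) :
  spectrum T = essential_spectrum T `|` diagonal_coefficients T C.
Proof.
apply/seteqP; split=> l.
  have [el|el] := pselect (essential_spectrum T l); first by left.
  by move=> sl; right; exact: spectrum_diagonal_coefficient sl.
have [el _|el] := pselect (essential_spectrum T l).
  exact: essential_spectrum_sub.
by case=> // dl; exact: diagonal_coefficient_spectrum dl.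
Qed.
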